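(* Let $k\ge 1$ and let $v_1,\dots,v_n\in\mathbb{R}^d$ be an arbitrary (fixed) sequence of $n$ vectors. Let $W^*$ be the optimal $k$-means cost of this multiset, and let $w^*>0$ be any number with $w^*\le W^*$. Run the semi-online $k$-means algorithm (described in the context) on the sequence with inputs $k$, $w^*$, $n$, and let $W=\sum_{t=1}^n\|v_t-c_t\|^2$ be the cost of its online assignments, where $c_t$ is the center output for $v_t$ at the time $v_t$ is processed. Then $$\mathbb{E}[W]=O(W^* ),$$ where the expectation is over the algorithm's internal randomness and the constant in $O(\cdot)$ is absolute.
   Context: Norms are Euclidean, and $\log$ denotes the base-2 logarithm. The optimal $k$-means cost of vectors $v_1,\dots,v_n$ is $W^*=\min\sum_{i=1}^k\sum_{v\in S_i}\|v-c_i\|_2^2$, the minimum taken over all partitions of the vectors into $k$ sets $S_1,\dots,S_k$ and all choices of centers $c_1,\dots,c_k\in\mathbb{R}^d$. For a point $v$ and a finite set $C$, $D(v,C)=\min_{c\in C}\|v-c\|$, with $D(v,\emptyset)=\infty$. Semi-online $k$-means algorithm (inputs: the stream $v_1,\dots,v_n$, $k$, $w^*$, $n$): initialize $C\gets\emptyset$, $r\gets1$, $q_1\gets0$, $f_1\gets w^*/(k\log n)$. For each vector $v$ of the stream, in order: with probability $p=\min(D^2(v,C)/f_r,1)$ (independently of all other random choices), set $C\gets C\cup\{v\}$ and $q_r\gets q_r+1$; then, if $q_r\ge 3k(1+\log n)$, set $r\gets r+1$, $q_r\gets0$, $f_r\gets 2f_{r-1}$; finally output (assign $v$ to) the center $c=\arg\min_{c\in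 C}\|v-c\|^2$. *)

(* Defs.v *)
From HB Require Import structures.
From mathcomp Require Import all_boot all_order all_algebra.
From mathcomp Require Import all_classical all_reals all_analysis.

Set Implicit Arguments.
Unset Strict Implicit.
Unset Printing Implicit Defensive.

Import Order.TTheory GRing.Theory Num.Theory.
Import numFieldNormedType.Exports.

Local Open Scope classical_set_scope.
Local Open Scope ring_scope.

Definition log2 {R : realType} (x : R) : R := ln x / ln 2.

(* The library norm on 'rV[R]_d is the sup norm, hence this definition. *)
Definition enorm {R : realType} {d : nat} (x : 'rV[R]_d) : R :=
  Num.sqrt (\sum_(i < d) x ord0 i ^+ 2).

(* A partition of the (indexed) vectors into k possibly empty sets is given by
   the map sending each index to the label of its set. *)
Definition kmeans_cost {R : realType} {d k n : nat} (v : n.-tuple 'rV[R]_d)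
    (S : {ffun 'I_n -> 'I_k}) (c : 'I_k -> 'rV[R]_d) : R :=
  \sum_(i < k) \sum_(t < n | S t == i) enorm (tnth v t - c i) ^+ 2.

(* For 0 < k this infimum is attained: see kmeans_opt_min below. *)
Definition kmeans_opt {R : realType} {d n : nat} (k : nat)
    (v : n.-tuple 'rV[R]_d) : R :=
  inf [set W | exists (S : {ffun 'I_n -> 'I_k}) (c : 'I_k -> 'rV[R]_d),
                 W = kmeans_cost v S c].

Definition dist_to {R : realType} {d : nat} (v : 'rV[R]_d) (C : seq 'rV[R]_d) :
    \bar R :=
  (\big[mine/+oo]_(c <- C) (enorm (v - c))%:E)%E.

(* sel C v is a nearest point of C to v, ties being broken arbitrarily. *)
Definition is_argmin_rule {R : realType} {d : nat}
    (sel : seq 'rV[R]_d -> 'rV[R]_d -> 'rV[R]_d) : Prop :=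
  forall (C : seq 'rV[R]_d) (v : 'rV[R]_d), C <> [::] ->
    sel C v \in C /\
    forall c, c \in C -> enorm (v - sel C v) ^+ 2 <= enorm (v - c) ^+ 2.

Record state (R : realType) (d : nat) := State {
  centers : seq 'rV[R]_d;
  phase : nat;    (* r *)
  opened : nat;   (* q_r *)
  fcost : R       (* f_r *)
}.

Definition init_state {R : realType} (d k n : nat) (w : R) : state R d :=
  State [::] 1 0 (w / (k%:R * log2 n%:R)).

Definition open_prob {R : realType} {d : nat} (st : state R d) (v : 'rV[R]_d) :
    R :=
  fine (mine (dist_to v (centers st) ^+ 2 * ((fcost st)^-1)%:E) 1)%E.

(* The update of the state when the coin tossed for v gives b. *)
Definition step {R : realType} {d : nat} (k n : nat) (st : state R d)
    (v : 'rV[R]_d) (b : bool) : state R d :=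
  let C := if b then v :: centers st else centers st in
  let q := (opened st + b)%N in
  if 3 * k%:R * (1 + log2 n%:R) <= q%:R :> R
  then State C (phase st).+1 0 (2 * fcost st)
  else State C (phase st) q (fcost st).

(* The probability that the successive coins for the stream vs give bs: each
   coin has the bias open_prob determined by the current state. *)
Fixpoint coins_prob {R : realType} {d : nat} (k n : nat) (st : state R d)
    (vs : seq 'rV[R]_d) (bs : seq bool) : R :=
  match vs, bs with
  | v :: vs', b :: bs' =>
      (if b then open_prob st v else 1 - open_prob st v) *
      coins_prob k n (step k n st v b) vs' bs'
  | _, _ => 1
  end.

(* The cost of the online assignments when the coins give bs. *)
Fixpoint online_cost {R : realType} {d : nat}
    (sel : seq 'rV[R]_d -> 'rV[R]_d -> 'rV[R]_d) (k n : nat) (st : state R d)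
    (vs : seq 'rV[R]_d) (bs : seq bool) : R :=
  match vs, bs with
  | v :: vs', b :: bs' =>
      let st' := step k n st v b in
      enorm (v - sel (centers st') v) ^+ 2 + online_cost sel k n st' vs' bs'
  | _, _ => 0
  end.

Definition expected_cost {R : realType} {d n : nat}
    (sel : seq 'rV[R]_d -> 'rV[R]_d -> 'rV[R]_d) (k : nat) (w : R)
    (v : n.-tuple 'rV[R]_d) : R :=
  \sum_(bs : n.-tuple bool)
    coins_prob k n (init_state d k n w) v bs *
    online_cost sel k n (init_state d k n w) v bs.

Lemma enorm_sqr {R : realType} {d : nat} (x : 'rV[R]_d) :
  enorm x ^+ 2 = \sum_(i < d) x ord0 i ^+ 2.
Proof. by rewrite sqr_sqrtr // sumr_ge0 // => i _; exact: sqr_ge0. Qed.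

Lemma sum_sqr_mean {R : realType} (T : finType) (P : pred T) (x : T -> R)
    (c : R) :
  \sum_(t | P t) (x t - (\sum_(t | P t) x t) / #|P|%:R) ^+ 2
    <= \sum_(t | P t) (x t - c) ^+ 2.
Proof.
have [P0|P0] := posnP #|P|.
  by rewrite !big_pred0 // => t; exact: (card0_eq P0).
set m := _ / _.
have hm : \sum_(t | P t) x t = m * #|P|%:R.
  by rewrite /m divfK // pnatr_eq0 -lt0n.
have hc : \sum_(t | P t) (x t - m) = 0.
  by rewrite big_split /= sumr_const hm mulNrn mulr_natr subrr.
have -> : \sum_(t | P t) (x t - c) ^+ 2 =
    \sum_(t | P t) (x t - m) ^+ 2 + \sum_(t | P t) (m - c) ^+ 2.
  transitivity (\sum_(t | P t) ((x t - m) ^+ 2 + (m - c) ^+ 2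
      + 2 * (m - c) * (x t - m))).
    apply: eq_bigr => t _.
    have -> : x t - c = (x t - m) + (m - c) by rewrite addrA subrK.
    by rewrite sqrrD addrAC -mulr_natl [(x t - m) * _]mulrC mulrA.
  by rewrite big_split /= -mulr_sumr hc mulr0 addr0 big_split.
by rewrite lerDl sumr_ge0 // => t _; exact: sqr_ge0.
Qed.

Lemma kmeans_opt_min {R : realType} {d n : nat} (k : nat)
    (v : n.-tuple 'rV[R]_d) : (0 < k)%N ->
  (exists (S : {ffun 'I_n -> 'I_k}) (c : 'I_k -> 'rV[R]_d),
     kmeans_opt k v = kmeans_cost v S c) /\
  (forall (S : {ffun 'I_n -> 'I_k}) (c : 'I_k -> 'rV[R]_d),
     kmeans_opt k v <= kmeans_cost v S c).
Proof.
move=> k0.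
pose m (S : {ffun 'I_n -> 'I_k}) (i : 'I_k) : 'rV[R]_d :=
  \row_j ((\sum_(t | S t == i) tnth v t ord0 j) / #|[pred t | S t == i]|%:R).
have hm S c : kmeans_cost v S (m S) <= kmeans_cost v S c.
  apply: ler_sum => i _.
  under eq_bigr do rewrite enorm_sqr.
  under [leRHS]eq_bigr do rewrite enorm_sqr.
  rewrite exchange_big [leRHS]exchange_big /=.
  apply: ler_sum => j _.
  under eq_bigr do rewrite !mxE.
  under [leRHS]eq_bigr do rewrite !mxE.
  exact: sum_sqr_mean.
pose S0 : {ffun 'I_n -> 'I_k} := [ffun=> Ordinal k0].
case: (@Order.TotalTheory.arg_minP _ _ _ S0 xpredT
  (fun S => kmeans_cost v S (m S)) isT) => S _ hS.
have lb (S' : {ffun 'I_n -> 'I_k}) c :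
    kmeans_cost v S (m S) <= kmeans_cost v S' c.
  exact: le_trans (hS S' isT) (hm _ _).
have e : kmeans_opt k v = kmeans_cost v S (m S).
  apply/eqP; rewrite eq_le; apply/andP; split.
    apply: ge_inf; last by exists S, (m S).
    by exists (kmeans_cost v S (m S)) => _ [S' [c ->]].
  apply: lb_le_inf; first by exists (kmeans_cost v S (m S)), S, (m S).
  by move=> _ [S' [c ->]].
by split=> [|S' c]; [exists S, (m S) | rewrite e].
Qed.

Lemma open_prob_nil {R : realType} {d : nat} (st : state R d) (v : 'rV[R]_d) :
  centers st = [::] -> 0 < fcost st -> open_prob st v = 1.
Proof.
move=> h f0; rewrite /open_prob /dist_to h big_nil expe2.
by rewrite mulyy gt0_mulye ?lte_fin ?invr_gt0 // min_r ?leey.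
Qed.

Lemma open_prob_itv {R : realType} {d : nat} (st : state R d) (v : 'rV[R]_d) :
  0 < fcost st -> 0 <= open_prob st v <= 1.
Proof.
move=> f0; rewrite /open_prob; set x := (_ * _)%E.
have x0 : (0 <= x)%E.
  by rewrite mule_ge0 ?lee_fin ?invr_ge0 ?(ltW f0) // sqre_ge0.
have m0 : (0 <= mine x 1)%E by rewrite le_min x0 lee_fin ler01.
have m1 : (mine x 1 <= 1)%E by rewrite ge_min lexx orbT.
by case: (mine x 1)%E m0 m1 => // r; rewrite !lee_fin /= => -> ->.
Qed.

Lemma coins_prob_total {R : realType} {d k n : nat} (N : nat) (st : state R d)
    (v : N.-tuple 'rV[R]_d) :
  \sum_(bs : N.-tuple bool) coins_prob k n st v bs = 1.
Proof.
elim: N st v => [|N IH] st v.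
  rewrite (big_pred1 [tuple]) => [|t]; last by apply/esym/eqP; exact: tuple0.
  by rewrite (tuple0 v).
have [x [v' ->]] : exists x (v' : N.-tuple 'rV[R]_d), v = [tuple of x :: v'].
  by exists (thead v), (behead_tuple v); exact: tuple_eta.
rewrite (reindex (fun p : bool * N.-tuple bool => [tuple of p.1 :: p.2])) /=.
  rewrite -(pair_bigA _ (fun b (bs : N.-tuple bool) =>
    (if b then open_prob st x else 1 - open_prob st x) *
      coins_prob k n (step k n st x b) v' bs)) /=.
  by rewrite big_bool /= -!mulr_sumr !IH !mulr1 addrC subrK.
exists (fun t => (thead t, behead_tuple t)) => [[b bs] _|t _] /=.
  by rewrite theadE; congr pair; exact: val_inj.
by rewrite -tuple_eta.
Qed.

(* Main.v *)
(** Cut each cluster of an optimal solution into at most [1 + log n] rings of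
    geometrically growing squared radius, starting at [2 W* / n]: two stream
    vectors [x], [y] of one ring satisfy [|y - x|^2 <= B y], where
    [B y = 6 a + 4 W* / n], [a] is the squared distance of [y] to its optimal
    center, and the [B y] sum up to at most [10 W*].  The expected cost of one
    step is at most [f] times the probability of opening a center, so it is
    paid for by the decrease of the expected value of the potential
    [f (q + 2 u) + 2 b], where [u] counts the rings that contain no center yet
    and [b] is the sum of [B] over the vectors still to come.  Its initial
    value is at most [4 w* + 20 W*]. *)

Require Import Defs.
From HB Require Import structures.
From mathcomp Require Import all_boot all_order all_algebra.
From mathcomp Require Import all_classical all_reals all_analysis.
From mathcomp Require Import lra.

Set Implicit Arguments.
Unset Strict Implicit.

Import Order.TTheory GRing.Theory Num.Theory.
Local Open Scope ring_scope.

(** * Distances, opening probabilities and assignment costs *)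

Section Norm.
Context {R : realType} {d : nat}.
Implicit Types (x y c v : 'rV[R]_d) (C : seq 'rV[R]_d).

Lemma enorm_ge0 x : 0 <= enorm x.
Proof. exact: sqrtr_ge0. Qed.

Lemma enorm0 : enorm (0 : 'rV[R]_d) = 0.
Proof. by rewrite /enorm big1 ?sqrtr0 // => i _; rewrite mxE expr0n. Qed.

(** Parallelogram law: coordinatewise, the slack is [(x + y - 2 c)^2]. *)
Lemma enorm_sqrB_le c x y :
  enorm (y - x) ^+ 2 <= 2 * (enorm (x - c) ^+ 2 + enorm (y - c) ^+ 2).
Proof.
rewrite !enorm_sqr -big_split /= mulr_sumr; apply: ler_sum => i _.
rewrite !mxE; have := sqr_ge0 (x ord0 i + y ord0 i - 2 * c ord0 i); lra.
Qed.

Lemma dist_to_attained v C : C <> [::] ->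
  exists2 c, c \in C & dist_to v C = (enorm (v - c))%:E /\
    forall c', c' \in C -> enorm (v - c) <= enorm (v - c').
Proof.
elim: C => // a C IH _; rewrite /dist_to big_cons.
case: C IH => [_|b C IH].
  exists a; rewrite ?mem_head // big_nil; split; first by rewrite min_l ?leey.
  by move=> c'; rewrite inE => /eqP ->.
have [//|c cC [+ hc]] := IH; rewrite /dist_to => ->.
have [ac|ca] := leP (enorm (v - a)) (enorm (v - c)).
  exists a; rewrite ?mem_head //; split; first by rewrite min_l ?lee_fin.
  move=> c'; rewrite inE => /predU1P[->//|/hc]; exact: le_trans.
exists c; first by rewrite inE cC orbT.
split; first by rewrite min_r // lee_fin ltW.
by move=> c'; rewrite inE => /predU1P[->|/hc //]; exact: ltW.
Qed.

Lemma open_probE (sel : seq 'rV[R]_d -> 'rV[R]_d -> 'rV[R]_d)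
    (st : state R d) v : is_argmin_rule sel -> centers st <> [::] ->
  open_prob st v =
    Num.min (enorm (v - sel (centers st) v) ^+ 2 / fcost st) 1.
Proof.
move=> hsel C0; have [c cC [dE hc]] := dist_to_attained v C0.
have [sC hs] := hsel _ v C0.
have -> : enorm (v - sel (centers st) v) ^+ 2 = enorm (v - c) ^+ 2.
  by apply/eqP; rewrite eq_le hs //= lerXn2r ?nnegrE ?enorm_ge0 ?hc.
by rewrite /open_prob dE -EFin_expe -EFinM -EFin_min.
Qed.

Lemma sel_mem_cost (sel : seq 'rV[R]_d -> 'rV[R]_d -> 'rV[R]_d) C v :
  is_argmin_rule sel -> v \in C -> enorm (v - sel C v) ^+ 2 = 0.
Proof.
move=> hsel vC; have C0 : C <> [::] by move=> C0; rewrite C0 in vC.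
have [_ /(_ _ vC)] := hsel C v C0.
rewrite subrr enorm0 expr0n => h.
by apply/eqP; rewrite eq_le h sqr_ge0.
Qed.

Lemma open_prob_le (sel : seq 'rV[R]_d -> 'rV[R]_d -> 'rV[R]_d)
    (st : state R d) v c : is_argmin_rule sel -> 0 < fcost st ->
  c \in centers st -> fcost st * open_prob st v <= enorm (v - c) ^+ 2.
Proof.
move=> hsel f0 cC; have C0 : centers st <> [::] by move=> C0; rewrite C0 in cC.
rewrite (open_probE _ hsel C0) mulrC -ler_pdivlMr // ge_min.
by rewrite ler_pM2r ?invr_gt0 // (hsel _ v C0).2.
Qed.

(** If the minimum defining the probability [p] is not cut off at 1, then [f * p] is the squared
    distance itself; otherwise [p = 1] and the left side vanishes. The latter covers the empty set
    of centers, where [sel] is unconstrained. *)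
Lemma expected_assignment_le (sel : seq 'rV[R]_d -> 'rV[R]_d -> 'rV[R]_d)
    (st : state R d) v : is_argmin_rule sel -> 0 < fcost st ->
  (1 - open_prob st v) * enorm (v - sel (centers st) v) ^+ 2
    <= fcost st * open_prob st v.
Proof.
move=> hsel f0; have /andP[p0 p1] := open_prob_itv v f0.
have [C0|/eqP C0] := eqVneq (centers st) [::].
  by rewrite open_prob_nil // subrr mul0r mulr1 ltW.
have := open_probE v hsel C0; set D := enorm _ ^+ 2.
have D0 : 0 <= D by exact: sqr_ge0.
have [_ pE|_ ->] := leP (D / fcost st) 1; last first.
  by rewrite subrr mul0r mulr1 ltW.
have <- : D = fcost st * open_prob st v.
  by rewrite pE mulrC divfK // gt_eqF.
by rewrite ler_piMl // lerBlDr lerDl.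
Qed.

End Norm.

(** * Conditioning on the first coin *)

Section Expectation.
Context {R : realType} {d : nat}.
Variables (sel : seq 'rV[R]_d -> 'rV[R]_d -> 'rV[R]_d) (k n : nat).

Definition expected_from (N : nat) (st : state R d) (vs : seq 'rV[R]_d) : R :=
  \sum_(bs : N.-tuple bool) coins_prob k n st vs bs *
    online_cost sel k n st vs bs.

Lemma expected_from_cons (N : nat) (st : state R d) (x : 'rV[R]_d)
    (vs : N.-tuple 'rV[R]_d) :
  let p := open_prob st x in
  let st1 := step k n st x true in let st0 := step k n st x false in
  expected_from N.+1 st (x :: vs) =
    p * (enorm (x - sel (centers st1) x) ^+ 2 + expected_from N st1 vs) +
    (1 - p) * (enorm (x - sel (centers st0) x) ^+ 2 + expected_from N st0 vs).
Proof.
rewrite /= /expected_from.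
rewrite (reindex (fun q : bool * N.-tuple bool => [tuple of q.1 :: q.2])) /=.
  rewrite -(pair_bigA _ (fun b (bs : N.-tuple bool) =>
    (if b then open_prob st x else 1 - open_prob st x) *
      coins_prob k n (step k n st x b) vs bs *
      (enorm (x - sel (centers (step k n st x b)) x) ^+ 2 +
       online_cost sel k n (step k n st x b) vs bs))) /=.
  rewrite big_bool /=.
  (* The cost [c] of the current step leaves the sum because the probabilities of the later coins
     add up to 1. *)
  have E a (c : R) st' : \sum_(bs : N.-tuple bool)
      a * coins_prob k n st' vs bs * (c + online_cost sel k n st' vs bs) =
      a * (c + \sum_(bs : N.-tuple bool)
        coins_prob k n st' vs bs * online_cost sel k n st' vs bs).
    under eq_bigr do rewrite -mulrA mulrDr.
    by rewrite -mulr_sumr big_split /= -mulr_suml coins_prob_total mul1r.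
  by rewrite !E.
exists (fun t => (thead t, behead_tuple t)) => [[b bs] _|t _] /=.
  by rewrite theadE; congr pair; exact: val_inj.
by rewrite -tuple_eta.
Qed.

End Expectation.

(** * The potential argument for an abstract labelling *)

Section Potential.
Context {R : realType} {d : nat}.
Variables (sel : seq 'rV[R]_d -> 'rV[R]_d -> 'rV[R]_d) (k n : nat).
Variables (L : finType) (lab : 'rV[R]_d -> L) (B : 'rV[R]_d -> R).
Variable V : seq 'rV[R]_d.
Hypothesis argmin_sel : is_argmin_rule sel.
Hypothesis labB : {in V &, forall x y, lab x = lab y ->
  enorm (y - x) ^+ 2 <= B y}.
Hypothesis card_lab : 2 * #|L|%:R <= 3 * k%:R * (1 + log2 n%:R) :> R.

Definition uncovered (C : seq 'rV[R]_d) : {set L} :=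
  [set l | l \notin map lab C].

(* A new center either covers a label, which pays [2 f], or lies within
   squared distance [B x] of a center carrying its label, so that
   [f * open_prob <= B x].  When [f] doubles, the [q >= 2 #|L|] centers
   opened in the phase pay for the doubling of the label term. *)
Definition potential (st : state R d) (vs : seq 'rV[R]_d) : R :=
  fcost st * ((opened st)%:R + 2 * #|uncovered (centers st)|%:R) +
  2 * \sum_(x <- vs) B x.

Lemma uncovered_cons_covered (C : seq 'rV[R]_d) x : lab x \in map lab C ->
  uncovered (x :: C) = uncovered C.
Proof.
move=> h; apply/setP => l; rewrite !inE negb_or /=.
by case: eqVneq => //= ->; rewrite h.
Qed.

Lemma card_uncovered_cons (C : seq 'rV[R]_d) x : lab x \notin map lab C ->
  #|uncovered C| = #|uncovered (x :: C)|.+1.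
Proof.
move=> h; rewrite (cardsD1 (lab x) (uncovered C)) inE h add1n; congr _.+1.
by apply: eq_card => l; rewrite !inE negb_or.
Qed.

Lemma potential_step_open (st : state R d) x vs : 0 < fcost st ->
  potential (step k n st x true) vs <=
    fcost st * ((opened st)%:R + 1 + 2 * #|uncovered (x :: centers st)|%:R) +
    2 * \sum_(y <- vs) B y.
Proof.
move=> f0; rewrite /potential /step /= addn1.
case: ifPn => [|_] /=; rewrite -[_.+1%:R]natr1 // => hM.
rewrite lerD2r add0r (mulrC 2 (fcost st)) -mulrA ler_pM2l //.
have : 2 * #|uncovered (x :: centers st)|%:R <= 2 * #|L|%:R :> R.
  by rewrite ler_pM2l ?ltr0n // ler_nat max_card.
by move: card_lab hM; lra.
Qed.

Lemma expected_le_potential (N : nat) (st : state R d)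
    (vs : N.-tuple 'rV[R]_d) : 0 < fcost st ->
  (opened st)%:R < 3 * k%:R * (1 + log2 n%:R) :> R ->
  {subset centers st <= V} -> {subset vs <= V} ->
  expected_from sel k n N st vs <= potential st vs.
Proof.
elim: N st vs => [|N IH] st vs f0 qM CV vsV.
  rewrite /expected_from big1 => [|bs _]; last by rewrite (tuple0 vs) mulr0.
  rewrite /potential (tuple0 vs) big_nil mulr0 addr0.
  by rewrite mulr_ge0 ?(ltW f0) // addr_ge0 ?mulr_ge0.
have [x [vs' vsE]] :
    exists x (vs' : N.-tuple 'rV[R]_d), vs = [tuple of x :: vs'].
  by exists (thead vs), (behead_tuple vs); exact: tuple_eta.
rewrite {}vsE in vsV *; rewrite expected_from_cons /=.
have xV : x \in V by rewrite vsV ?mem_head.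
have vs'V : {subset vs' <= V} by move=> y h; rewrite vsV // inE h orbT.
have /andP[p0 p1] := open_prob_itv x f0.
have M0 : 0 < 3 * k%:R * (1 + log2 n%:R) :> R by exact: le_lt_trans qM.
(* Since [opened] is below the threshold, only a successful coin can end a phase. *)
have st0E : step k n st x false = st.
  rewrite /step addn0 leNgt qM /=.
  by case: (st).
set st1 := step k n st x true.
have c1 : centers st1 = x :: centers st by rewrite /st1 /step; case: ifP.
have H1 : expected_from sel k n N st1 vs' <= potential st1 vs'.
  apply: IH => //.
  - by rewrite /st1 /step; case: ifP => //= _; rewrite mulr_gt0.
  - by rewrite /st1 /step; case: ifPn => //=; rewrite -ltNge.
  - by move=> y; rewrite c1 inE => /predU1P[->|/CV].
have H0 := IH st vs' f0 qM CV vs'V.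
have HA := expected_assignment_le x argmin_sel f0.
have HS := potential_step_open x vs' f0.
rewrite st0E sel_mem_cost ?c1 ?mem_head // add0r.
move: H0 HA; rewrite /potential big_cons.
set p := open_prob st x in p0 p1 *.
set D := enorm _ ^+ 2; set f := fcost st in f0 *; set q := _%:R : R.
set S := \sum_(_ <- _) _; set E0 := expected_from _ _ _ _ st _.
have {}H1 := le_trans H1 HS; move: H1.
rewrite -/f -/q -/S.
set E1 := expected_from _ _ _ _ _ _ => H1 H0 HA.
have P1 := ler_wpM2l p0 H1.
have p1' : 0 <= 1 - p by rewrite subr_ge0.
have P0 := ler_wpM2l p1' H0.
(* Covered label: the assignment and the growth of [q] cost at most [f * p] each in expectation, and
   [2 * B x] leaves the sum. *)
have [cov|uncov] := boolP (lab x \in map lab (centers st)).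
  rewrite (uncovered_cons_covered cov) in P1.
  have /mapP[y yC xy] := cov.
  have : f * p <= B x.
    apply: le_trans (open_prob_le x argmin_sel f0 yC) _.
    exact: labB (CV _ yC) xV (esym xy).
  lra.
(* New label: opening changes [f * (q + 2 u)] by [f - 2 f], and the expected drop [f * p] pays for
   the assignment. *)
rewrite (card_uncovered_cons uncov) -natr1 in P0 *.
have : 0 <= B x.
  by apply: le_trans (labB xV xV erefl); exact: sqr_ge0.
lra.
Qed.

End Potential.

(** * Dyadic rings and logarithms *)

Section Rings.
Context {R : realType}.

(** As [trunc_log 2 0 = 0], ring 0 is the whole of [0, 2) among nonnegative [r]. *)
Definition ring_index (r : R) : nat := trunc_log 2 (Num.truncn r).

Lemma ring_index_le (r : R) (n : nat) : r <= n%:R ->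
  (ring_index r <= trunc_log 2 n)%N.
Proof. by move=> rn; rewrite leq_trunc_log // -(natrK (R := R) n) le_truncn. Qed.

Lemma ring_index_eq_le (r s : R) : 0 <= r -> 0 <= s ->
  ring_index r = ring_index s -> r <= 2 * s + 2.
Proof.
move=> r0 s0 rs.
have r1 : r < (2 ^ (ring_index r).+1)%:R.
  apply: lt_le_trans (truncnS_gt r) _.
  by rewrite ler_nat trunc_log_ltn.
(* The [+ 1] is for ring 0, where [s] may be less than 1. *)
have s1 : (2 ^ ring_index s)%:R <= s + 1.
  have [t0|t0] := posnP (Num.truncn s).
    by rewrite /ring_index t0 trunc_log0 expn0 lerDr.
  apply: (@le_trans _ _ (Num.truncn s)%:R).
    by rewrite ler_nat trunc_logP.
  by apply: (@le_trans _ _ s); rewrite ?truncn_le ?lerDl.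
move: r1; rewrite rs expnS natrM; lra.
Qed.

Lemma trunc_log_le_log2 (n : nat) : (0 < n)%N ->
  (trunc_log 2 n)%:R <= log2 n%:R :> R.
Proof.
move=> n0; rewrite /log2 ler_pdivlMr ?ln_gt0 ?ltr1n //.
rewrite mulr_natl -lnXn ?ltr0n // -natrX.
by rewrite ler_ln ?posrE ?ltr0n ?expn_gt0 // ler_nat trunc_logP.
Qed.

Lemma log2_ge1 (n : nat) : (1 < n)%N -> 1 <= log2 n%:R :> R.
Proof.
move=> n1; rewrite /log2 ler_pdivlMr ?ln_gt0 ?ltr1n // mul1r.
by rewrite ler_ln ?posrE ?ltr0n ?ler_nat // ltnW.
Qed.

End Rings.

(** * Optimal solutions *)

Section KMeans.
Context {R : realType} {d n : nat}.

(** A single vector is its own center at cost 0. Having two vectors makes [log2 n] at least 1, so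
    the initial [f] is a genuine quotient. *)
Lemma kmeans_opt_gt0_size (k : nat) (v : n.-tuple 'rV[R]_d) : (0 < k)%N ->
  0 < kmeans_opt k v -> (1 < n)%N.
Proof.
move=> k0; rewrite ltNge; apply: contraNT; rewrite -leqNgt => n1.
have [_ opt_le] := kmeans_opt_min v k0.
apply: le_trans (opt_le [ffun=> Ordinal k0] (fun=> head 0 v)) _.
rewrite /kmeans_cost big1 // => i _; rewrite big1 // => t _.
have t0 : val t = 0%N by case: t => -[|m] //= /leq_trans /(_ n1).
by rewrite (tnth_nth 0) t0 nth0 subrr enorm0 expr0n.
Qed.

(** Reassigning each vector to a nearest optimal center makes the cluster a function of the vector
    rather than of its index, as [lab] requires. *)
Lemma kmeans_centersP (k : nat) (v : n.-tuple 'rV[R]_d) : (0 < k)%N ->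
  exists (c : 'I_k -> 'rV[R]_d) (g : 'rV[R]_d -> 'I_k),
    \sum_(x <- v) enorm (x - c (g x)) ^+ 2 <= kmeans_opt k v.
Proof.
move=> k0; have [[S [c ->]] _] := kmeans_opt_min v k0.
pose i0 := Ordinal k0.
exists c, (fun x => [arg min_(i < i0) enorm (x - c i) ^+ 2])%O.
rewrite /kmeans_cost big_tuple.
rewrite [leRHS](_ : _ = \sum_t enorm (tnth v t - c (S t)) ^+ 2).
  by apply: ler_sum => t _; case: arg_minP => // i _; apply.
rewrite [RHS](partition_big S predT) //=.
by apply: eq_bigr => i _; apply: eq_bigr => t /eqP ->.
Qed.

End KMeans.

(** * The rings of an optimal solution and the final bound *)

Theorem theorem2 (R : realType) :
  exists K : R, 0 < K /\
    forall (d k n : nat) (v : n.-tuple 'rV[R]_d) (w : R)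
           (sel : seq 'rV[R]_d -> 'rV[R]_d -> 'rV[R]_d),
      (1 <= k)%N ->
      is_argmin_rule sel ->
      0 < w -> w <= kmeans_opt k v ->
      expected_cost sel k w v <= K * kmeans_opt k v.
Proof.
exists 24; split=> // d k n v w sel k0 hsel w0 wW.
have W0 := lt_le_trans w0 wW.
have n1 := kmeans_opt_gt0_size k0 W0.
have n0 : 0 < n%:R :> R by rewrite ltr0n ltnW.
have [c [g cg]] := kmeans_centersP v k0.
set W := kmeans_opt k v in wW W0 cg *.
pose a x := enorm (x - c (g x)) ^+ 2.
have a0 x : 0 <= a x by exact: sqr_ge0.
pose A := W / n%:R.
have A0 : 0 < A by rewrite divr_gt0.
have aV x : x \in v -> a x / A <= n%:R.
  move=> xv; rewrite ler_pdivrMr // mulrC divfK ?gt_eqF //.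
  apply: le_trans cg; rewrite (perm_big _ (perm_to_rem xv)) big_cons lerDl.
  by apply: sumr_ge0 => y _; exact: a0.
pose T := trunc_log 2 n.
(* By [aV], the ring index of a stream vector is at most [T], so [inord] does not fall back to its
   default there. *)
pose lab x : 'I_k * 'I_T.+1 := (g x, inord (ring_index (a x / A))).
(* From [|y - x|^2 <= 2 (a x + a y)] and, within a ring, [a x <= 2 a y + 2 A]. *)
pose B x := 6 * a x + 4 * A.
have labB : {in v : seq _ &, forall x y, lab x = lab y ->
    enorm (y - x) ^+ 2 <= B y}.
  move=> x y xv yv [gxy /(congr1 val)] /=.
  rewrite !inordK ?ltnS ?ring_index_le ?aV // => /ring_index_eq_le.
  move=> /(_ (divr_ge0 (a0 x) (ltW A0)) (divr_ge0 (a0 y) (ltW A0))).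
  rewrite ler_pdivrMr // mulrDl -mulrA divfK ?gt_eqF // => axy.
  apply: le_trans (enorm_sqrB_le (c (g y)) x y) _.
  by rewrite -{1}gxy -/(a x) -/(a y) /B; lra.
have l1 := @log2_ge1 R _ n1.
have k0R : 0 < k%:R :> R by rewrite ltr0n.
have cardL : #|{: 'I_k * 'I_T.+1}|%:R <= k%:R * (1 + log2 n%:R) :> R.
  rewrite card_prod !card_ord natrM ler_pM2l // -natr1 addrC lerD2l.
  exact/trunc_log_le_log2/ltnW.
have kl0 : 0 < k%:R * (1 + log2 n%:R) :> R by rewrite mulr_gt0 //; lra.
have f0 : 0 < w / (k%:R * log2 n%:R) by rewrite divr_gt0 // mulr_gt0 //; lra.
have := @expected_le_potential R d sel k n _ lab B v hsel labB _ n
  (init_state d k n w) v f0 _ _ _.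
rewrite /expected_from -/(expected_cost sel k w v) => H.
apply: le_trans (H _ _ _ _) _ => //; [by lra | by rewrite /=; lra |].
rewrite /potential /= add0r.
have SB : \sum_(x <- v) B x <= 10 * W.
  rewrite big_split /= -mulr_sumr [X in _ + X](_ : _ = 4 * W).
    by move: cg; rewrite -/a; lra.
  rewrite big_tuple sumr_const card_ord -[_ *+ n]mulr_natr -mulrA.
  by rewrite divfK ?gt_eqF.
(* There are at most [k (1 + log n) <= 2 k log n] labels, and the initial [f] cancels [k log n]. *)
have U2 : w / (k%:R * log2 n%:R) * #|uncovered lab [::]|%:R <= 2 * w.
  apply: (@le_trans _ _ (w / (k%:R * log2 n%:R) * (k%:R * (2 * log2 n%:R)))).
    rewrite ler_pM2l //; apply: le_trans (_ : _ <= #|{: 'I_k * 'I_T.+1}|%:R) _.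
      by rewrite ler_nat max_card.
    by apply: le_trans cardL _; rewrite ler_pM2l //; lra.
  rewrite (mulrCA k%:R 2) (mulrCA _ 2) divfK // gt_eqF // mulr_gt0 //.
  exact: lt_le_trans l1.
rewrite mulrCA; lra.
Qed.
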